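(* Let $p, I$ be positive integers, let $\beta_1,\dots,\beta_I\in\mathbb{R}$ and let $L, D_1, D_2,\dots,D_{2I}\in\mathbb{R}^{3\times 3}$. Define $F:\mathbb{R}^{p\times p}\to\mathbb{R}^{p\times p}$ by $$F(U) = L*U + \sum_{i=1}^I \beta_i\,(D_{2i-1}*U)\odot (D_{2i}*U).$$ Then there exist parameters $$\mathcal{K}\in\mathbb{R}^{(4+6I)\times 1\times 3\times 3},\quad \mathcal{H}\in\mathbb{R}^{1\times (4+6I)\times 1\times 1},\quad b_1\in\mathbb{R}^{4+6I},\quad b_2\in\mathbb{R},$$ such that the map $$F_\theta(U)=\mathcal{H}*\sigma_2\left(\mathcal{K}*U+b_1\right)+b_2,\qquad \theta=(\mathcal{K},\mathcal{H},b_1,b_2),$$ where $\sigma_2(x)=\max\{0,x\}^2$ is applied entry-wise, satisfies $F_\theta(U)=F(U)$ for every $U\in\mathbb{R}^{p\times p}$.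
   Context: $\odot$ denotes the entry-wise product of matrices. Convolution with a single filter (''same'' convolution with periodic padding): for $K\in\mathbb{R}^{3\times 3}$ and $U\in\mathbb{R}^{p\times p}$, $K*U\in\mathbb{R}^{p\times p}$ is the linear map in $U$ given by $$(K*U)_{hk}=\sum_{a=1}^{3}\sum_{b=1}^{3}K_{ab}\,U_{h+a-2,\;k+b-2},\qquad h,k=1,\dots,p,$$ with the row and column indices of $U$ taken modulo $p$ in $\{1,\dots,p\}$. That is, the Frobenius inner product of $K$ is taken with each contiguous $3\times3$ submatrix of the periodically padded matrix. For a $1\times 1$ filter $K\in\mathbb{R}$, $K*U$ is the scalar multiple $KU$. Multi-channel convolution: for a third-order tensor $\boldsymbol{U}=[\boldsymbol U_1,\dots,\boldsymbol U_{C_i}]\in\mathbb{R}^{C_i\times p\times p}$ and a fourth-order tensor $\mathcal{K}\in\mathbb{R}^{C_o\times C_i\times s\times s}$ with filters $\mathcal{K}_{i,j}\in\mathbb{R}^{s\times s}$, the result $\mathcal{K}*\boldsymbol{U}\in\mathbb{R}^{C_o\times p\times p}$ has channels $$(\mathcal{K}*\boldsymbol{U})_i=\sum_{j=1}^{C_i}\mathcal{K}_{i,j}*\boldsymbol{U}_j\in\mathbb{R}^{p\times p},\qquad i=1,\dots,C_o.$$ A matrix in $\mathbb{R}^{p\times p}$ is identified with a tensor in $\mathbb{R}^{1\times p\times p}$. Adding a bias $b\in\mathbb{R}^{C_o}$ to a tensor in $\mathbb{R}^{C_o\times p\times p}$ means adding the scalar $b_i$ to every entry of the $i$-th channel. 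*)

(* Defs.v *)
From HB Require Import structures.
From mathcomp Require Import all_boot all_order all_algebra.
From mathcomp Require Import reals.

Set Implicit Arguments.
Unset Strict Implicit.
Unset Printing Implicit Defensive.

Import Order.TTheory GRing.Theory Num.Theory.

Local Open Scope ring_scope.

Definition hadamard (R : realType) (m n : nat) (A B : 'M[R]_(m, n)) :
    'M[R]_(m, n) :=
  map2_mx *%R A B.

(* Indices are 0-based: the entry of a centred s x s window (s odd) with offset
   a around position h is h + a - s./2 modulo p, as stated in wshiftE. For
   s = 3 and 1-based h, a this is h + a - 2. *)
Definition wshift (p s : nat) (h : 'I_p) (a : 'I_s) : 'I_p :=
  iter a (@ordS p) (iter s./2 (@ord_pred p) h).

Definition conv (R : realType) (p s : nat) (K : 'M[R]_s) (U : 'M[R]_p) :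
    'M[R]_p :=
  \matrix_(h < p, k < p)
    \sum_(a < s) \sum_(b < s) K a b * U (wshift h a) (wshift k b).

(* C x p x p tensors, as families of channels. *)
Definition tensor (R : realType) (C p : nat) : Type :=
  {ffun 'I_C -> 'M[R]_p}.

(* Co x Ci x s x s tensors, as Co x Ci matrices of filters. *)
Definition kernel (R : realType) (Co Ci s : nat) : Type :=
  'M['M[R]_s]_(Co, Ci).

Definition tensor_of_mx (R : realType) (p : nat) (U : 'M[R]_p) :
    tensor R 1 p :=
  [ffun => U].

Definition mconv (R : realType) (p Co Ci s : nat)
    (K : kernel R Co Ci s) (U : tensor R Ci p) : tensor R Co p :=
  [ffun i => \sum_(j < Ci) conv (K i j) (U j)].

Definition add_bias (R : realType) (p C : nat)
    (U : tensor R C p) (b : 'cV[R]_C) : tensor R C p :=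
  [ffun i => U i + const_mx (b i 0)].

Definition map_tensor (R : realType) (p C : nat)
    (f : R -> R) (U : tensor R C p) : tensor R C p :=
  [ffun i => map_mx f (U i)].

Definition sigma2 (R : realType) (x : R) : R := Num.max 0 x ^+ 2.

Definition network (R : realType) (p C : nat)
    (K : kernel R C 1 3) (H : kernel R 1 C 1) (b1 : 'cV[R]_C) (b2 : R)
    (U : 'M[R]_p) : tensor R 1 p :=
  add_bias
    (mconv H (map_tensor (@sigma2 R) (add_bias (mconv K (tensor_of_mx U)) b1)))
    (const_mx b2).

Fact fst_idx_subproof (n : nat) (i : 'I_n) : (2 * i < 2 * n)%N.
Proof. by rewrite ltn_pmul2l. Qed.

Fact snd_idx_subproof (n : nat) (i : 'I_n) : ((2 * i).+1 < 2 * n)%N.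
Proof. by rewrite !mul2n ltn_Sdouble. Qed.

(* The 0-based counterparts of the 1-based indices 2i-1 and 2i. *)
Definition fst_idx (n : nat) (i : 'I_n) : 'I_(2 * n) :=
  Ordinal (fst_idx_subproof i).
Definition snd_idx (n : nat) (i : 'I_n) : 'I_(2 * n) :=
  Ordinal (snd_idx_subproof i).

Definition quad_map (R : realType) (p I : nat) (beta : 'I_I -> R)
    (L : 'M[R]_3) (D : 'I_(2 * I) -> 'M[R]_3) (U : 'M[R]_p) : 'M[R]_p :=
  conv L U
  + \sum_(i < I)
      beta i *: hadamard (conv (D (fst_idx i)) U) (conv (D (snd_idx i)) U).

Lemma wshiftE (p s : nat) (h : 'I_p) (a : 'I_s) :
  (wshift h a + s./2 = h + a %[mod p])%N.
Proof.
have itS n (i : 'I_p) : (iter n (@ordS p) i = i + n %[mod p])%N.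
  elim: n => [|n IHn]; first by rewrite addn0.
  by rewrite iterS /= modn_mod -addn1 -modnDml IHn modnDml addn1 addnS.
have iterK n (i : 'I_p) : iter n (@ordS p) (iter n (@ord_pred p) i) = i.
  by elim: n i => // n IHn i; rewrite iterS iterSr IHn ord_predK.
rewrite /wshift -modnDml itS modnDml addnAC -modnDml -itS iterK.
by rewrite modnDml.
Qed.

(* For 1 x 1 filters, convolution is scalar multiplication. *)
Lemma conv_1x1 (R : realType) (p : nat) (K : 'M[R]_1) (U : 'M[R]_p) :
  conv K U = K 0 0 *: U.
Proof. by apply/matrixP=> h k; rewrite !mxE !big_ord1. Qed.

(* Main.v *)
(* A square is a sum of two activations, y ^+ 2 = sigma2 y + sigma2 (- y).
   Hence the linear part x = ((x + 1) ^+ 2 - (x - 1) ^+ 2) / 4 costs four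
   channels, and each product x * y = ((x + y) ^+ 2 - x ^+ 2 - y ^+ 2) / 2
   costs six; channels add up under sums of networks. *)

Require Import Defs.
From HB Require Import structures.
From mathcomp Require Import all_boot all_order all_algebra.
From mathcomp Require Import reals.
From mathcomp Require Import ring.

Set Implicit Arguments.
Unset Strict Implicit.
Unset Printing Implicit Defensive.

Import Order.TTheory GRing.Theory Num.Theory.

Local Open Scope ring_scope.

Lemma sigma2_sqr (R : realType) (y : R) : sigma2 y + sigma2 (- y) = y ^+ 2.
Proof.
(* [lerP] already evaluates [Num.max 0 y]; only the maximum at [- y] remains. *)
rewrite /sigma2; case: (lerP 0 y) => y0.
  by rewrite (max_l (_ : - y <= 0)) ?oppr_le0// expr0n addr0.
by rewrite (max_r (_ : 0 <= - y)) ?oppr_ge0 1?ltW// expr0n add0r sqrrN.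
Qed.

(** Linearity in the filter lets one channel compute a sum of two convolutions of the same input. *)
Lemma convD (R : realType) (p s : nat) (K1 K2 : 'M[R]_s) (U : 'M[R]_p) :
  conv (K1 + K2) U = conv K1 U + conv K2 U.
Proof.
apply/matrixP => h k; rewrite !mxE -big_split; apply: eq_bigr => a _.
by rewrite -big_split; apply: eq_bigr => b _; rewrite mxE mulrDl.
Qed.

Lemma convN (R : realType) (p s : nat) (K : 'M[R]_s) (U : 'M[R]_p) :
  conv (- K) U = - conv K U.
Proof.
apply/matrixP => h k; rewrite !mxE -sumrN; apply: eq_bigr => a _.
by rewrite -sumrN; apply: eq_bigr => b _; rewrite mxE mulNr.
Qed.

Lemma networkE (R : realType) (p C : nat) (K : kernel R C 1 3)
    (H : kernel R 1 C 1) (b1 : 'cV[R]_C) (b2 : R) (U : 'M[R]_p) :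
  network K H b1 b2 U = tensor_of_mx
    (\sum_(c < C) H 0 c 0 0 *:
       map_mx (@sigma2 R) (conv (K c 0) U + const_mx (b1 c 0)) + const_mx b2).
Proof.
apply/ffunP => i; rewrite !ffunE !mxE ord1; congr (_ + _).
by apply: eq_bigr => c _; rewrite conv_1x1 !ffunE big_ord1 ffunE.
Qed.

(** The exact width [C] is an index, so the closure lemmas below also count channels. The parameters
    are chosen before [U]. *)
Definition realizable (R : realType) (p C : nat) (F : 'M[R]_p -> 'M[R]_p) :=
  exists (K : kernel R C 1 3) (H : kernel R 1 C 1) (b1 : 'cV[R]_C) (b2 : R),
    forall U : 'M[R]_p, network K H b1 b2 U = tensor_of_mx (F U).

Lemma eq_realizable (R : realType) (p C : nat) (F G : 'M[R]_p -> 'M[R]_p) :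
  F =1 G -> realizable C F -> realizable C G.
Proof.
move=> FG [K [H [b1 [b2 KF]]]]; exists K, H, b1, b2 => U.
by rewrite KF FG.
Qed.

Lemma realizable0 (R : realType) (p : nat) :
  realizable 0 (fun _ : 'M[R]_p => 0).
Proof.
exists (const_mx 0), (const_mx 0), 0, 0 => U.
by rewrite networkE big_ord0 add0r.
Qed.

Lemma realizable_sigma2 (R : realType) (p : nat) (c b : R) (K : 'M[R]_3) :
  realizable 1 (fun U : 'M[R]_p =>
    c *: map_mx (@sigma2 R) (conv K U + const_mx b)).
Proof.
exists (const_mx K), (const_mx (const_mx c)), (const_mx b), 0 => U.
by rewrite networkE big_ord1 !mxE raddf0 addr0.
Qed.

(** Two networks run in parallel: their hidden channels are stacked, and the output layer adds the
    results. *)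
Lemma realizableD (R : realType) (p C1 C2 : nat) (F G : 'M[R]_p -> 'M[R]_p) :
  realizable C1 F -> realizable C2 G ->
  realizable (C1 + C2) (fun U => F U + G U).
Proof.
move=> [K [H [b [d KF]]]] [K' [H' [b' [d' KG]]]].
exists (col_mx K K'), (row_mx H H'), (col_mx b b'), (d + d') => U.
(* Reading the only output channel turns both tensor equations into matrix equations. *)
move: (KF U) (KG U); rewrite !networkE => /ffunP/(_ 0) + /ffunP/(_ 0).
rewrite !ffunE => <- <-; congr tensor_of_mx.
rewrite raddfD addrACA big_split_ord; congr (_ + _ + _); apply: eq_bigr => i _.
  by rewrite row_mxEl !col_mxEu.
by rewrite row_mxEr !col_mxEd.
Qed.

Lemma realizable_sum (R : realType) (p C n : nat)
    (F : 'I_n -> 'M[R]_p -> 'M[R]_p) :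
  (forall i, realizable C (F i)) ->
  realizable (C * n) (fun U => \sum_(i < n) F i U).
Proof.
elim: n F => [|n IHn] F FP.
  rewrite muln0; apply: eq_realizable (realizable0 R p) => U.
  by rewrite big_ord0.
rewrite mulnS.
apply: eq_realizable (realizableD (FP ord0)
  (IHn _ (fun i => FP (lift ord0 i)))).
by move=> U; rewrite big_ord_recl.
Qed.

Lemma realizable_sqr (R : realType) (p : nat) (c b : R) (K : 'M[R]_3) :
  realizable 2 (fun U : 'M[R]_p =>
    c *: map_mx (fun x => x ^+ 2) (conv K U + const_mx b)).
Proof.
(* Negating both filter and bias turns the pre-activation [y] into [- y], as [sigma2_sqr]
   requires. *)
apply: eq_realizable
  (realizableD (realizable_sigma2 p c b K) (realizable_sigma2 p c (- b) (- K))).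
move=> U; rewrite -scalerDr convN; congr (_ *: _); apply/matrixP => h k.
by rewrite !mxE -opprD sigma2_sqr.
Qed.

Lemma realizable_conv (R : realType) (p : nat) (L : 'M[R]_3) :
  realizable 4 (@conv R p 3 L).
Proof.
apply: eq_realizable (realizableD (realizable_sqr p 4^-1 1 L)
                                  (realizable_sqr p (- 4^-1) (- 1) L)).
(* With the convolution made opaque, [mxE] stops at its entries and [field] treats them as atoms. *)
move=> U; move: (conv L U) => A.
by apply/matrixP => h k; rewrite !mxE; field.
Qed.

Lemma realizable_hadamard (R : realType) (p : nat) (c : R) (D1 D2 : 'M[R]_3) :
  realizable 6 (fun U : 'M[R]_p => c *: hadamard (conv D1 U) (conv D2 U)).
Proof.
(* Polarization of the product, with [c] absorbed into the output weights; two channels per square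
   give the six. *)
apply: eq_realizable (realizableD (realizable_sqr p (c / 2) 0 (D1 + D2))
  (realizableD (realizable_sqr p (- (c / 2)) 0 D1)
               (realizable_sqr p (- (c / 2)) 0 D2))).
move=> U; rewrite convD /hadamard.
move: (conv D1 U) (conv D2 U) => A B.
by apply/matrixP => h k; rewrite !mxE; field.
Qed.

Theorem theorem1 (R : realType) (p I : nat) (hp : (0 < p)%N) (hI : (0 < I)%N)
    (beta : 'I_I -> R) (L : 'M[R]_3) (D : 'I_(2 * I) -> 'M[R]_3) :
  exists (K : kernel R (4 + 6 * I) 1 3) (H : kernel R 1 (4 + 6 * I) 1)
         (b1 : 'cV[R]_(4 + 6 * I)) (b2 : R),
    forall U : 'M[R]_p,
      network K H b1 b2 U = tensor_of_mx (quad_map beta L D U).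
Proof.
(* Up to unfolding, the goal is [realizable (4 + 6 * I) (quad_map beta L D)]; both sums split alike
   into linear and quadratic parts. *)
apply: realizableD; first exact: realizable_conv.
by apply: realizable_sum => i; apply: realizable_hadamard.
Qed.
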